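(* For all integers $m,n$ with $2\leq m\leq n$, the triangulated-rectangular grid $T_{m,n}$ satisfies $$\sigma_T(T_{m,n})=m.$$
   Context: All graphs are finite and simple. For a connected graph $G$ (with at least one edge) and a spanning tree $T$ of $G$, let $d_T(u,v)$ be the distance between $u$ and $v$ in $T$. The stretch of $T$ is $\sigma_T(G,T):=\max_{uv\in E(G)} d_T(u,v)$, and the tree-stretch of $G$ is $\sigma_T(G):=\min\{\sigma_T(G,T): T \text{ is a spanning tree of } G\}$ (the subscript $T$ in $\sigma_T(G)$ is part of the notation and does not refer to a particular tree). The triangulated-rectangular grid $T_{m,n}$ is the graph with vertex set $\{(x,y)\in\mathbb{Z}^2: 0\leq y\leq m-1,\ 0\leq x\leq n-1\}$ in which two vertices $(x,y)$ and $(x',y')$ are adjacent if and only if either $|x-x'|+|y-y'|=1$, or both $|x-x'|+|y-y'|=2$ and $x+y=x'+y'$. *)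

(* Defs.v *)
From mathcomp Require Import all_boot ssrint.

Set Implicit Arguments.
Unset Strict Implicit.
Unset Printing Implicit Defensive.

Local Open Scope nat_scope.

Record sgraph := SGraph {
  vertex :> finType;
  adj : rel vertex;
  adj_sym : symmetric adj;
  adj_irrefl : irreflexive adj
}.

Section Distance.

Variables (V : finType) (t : rel V).
Implicit Types u v : V.

Definition has_walk u v (k : nat) : bool :=
  [exists p : k.-tuple V, path t u p && (last u p == v)].

(* The least length of a walk from u to v. A shortest walk has fewer than #|V|
   steps; the value is #|V| when v cannot be reached from u. *)
Definition gdist u v : nat := find (has_walk u v) (iota 0 #|V|).

Lemma has_walkP u v k :
  reflect (exists p, [/\ path t u p, last u p = v & size p = k])
          (has_walk u v k).
Proof.
apply: (iffP existsP) => [[p /andP[tp /eqP pv]]|[p [tp pv /eqP sp]]].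
  by exists p; rewrite size_tuple.
by exists (Tuple sp); rewrite /= tp pv eqxx.
Qed.

Lemma gdist_walk u v : connect t u v -> has_walk u v (gdist u v).
Proof.
move=> /connectP[p tp ->]; case: (shortenP tp) => q tq uq _.
have q_lt : size q < #|V| by rewrite -[_.+1]/(size (u :: q)) -(card_uniqP uq) max_card.
have W : has (has_walk u (last u q)) (iota 0 #|V|).
  apply/hasP; exists (size q); first by rewrite mem_iota.
  by apply/has_walkP; exists q.
by have := nth_find 0 W; rewrite nth_iota // -[X in _ < X](size_iota 0) -has_find.
Qed.

Lemma gdist_min u v p : path t u p -> last u p = v -> gdist u v <= size p.
Proof.
move=> tp pv; rewrite leqNgt; apply/negP => lt_p.
have p_lt : size p < #|V|.
  by apply: leq_trans lt_p _; rewrite -[X in _ <= X](size_iota 0) find_size.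
have := before_find 0 lt_p; rewrite nth_iota // add0n.
by move=> /negbT/negP; apply; apply/has_walkP; exists p.
Qed.

Lemma gdist_le_card u v : gdist u v <= #|V|.
Proof. by rewrite -[X in _ <= X](size_iota 0) find_size. Qed.

Definition connected_rel : bool := [forall u, forall v, connect t u v].

(* A simple cycle has at most #|V| vertices, so bounding its length loses
   nothing; see acyclicP. Cycles have length at least 3, since a symmetric
   relation has the degenerate cycle u, v for each of its edges. *)
Definition acyclic : bool :=
  [forall k : 'I_#|V|.+1, forall c : k.-tuple V, (2 < k) ==> ~~ ucycleb t c].

Lemma acyclicP :
  reflect (forall c : seq V, 2 < size c -> ~ ucycle t c) acyclic.
Proof.
apply: (iffP forallP) => [ac c c3 uc|ac k].
  have c_lt : size c < #|V|.+1.
    by case/andP: uc => _ /card_uniqP <-; rewrite ltnS max_card.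
  have /forallP/(_ (in_tuple c))/implyP/(_ c3) := ac (Ordinal c_lt).
  by move/negP; apply.
apply/forallP => c; apply/implyP => k3; apply/negP; apply: ac.
by rewrite size_tuple.
Qed.

End Distance.

(* A spanning subgraph of G is given by its set of arcs F, which contains both
   orientations of each edge. *)
Definition arc_rel (V : finType) (F : {set V * V}) : rel V :=
  [rel u v | (u, v) \in F].

Definition spanning_tree (G : sgraph) (F : {set G * G}) : bool :=
  [&& [forall u, forall v, arc_rel F u v == arc_rel F v u],
      [forall u, forall v, arc_rel F u v ==> adj u v],
      connected_rel (arc_rel F) & acyclic (arc_rel F)].

Definition stretch (G : sgraph) (F : {set G * G}) : nat :=
  \max_(e : G * G | adj e.1 e.2) gdist (arc_rel F) e.1 e.2.

Lemma stretch_le_card (G : sgraph) (F : {set G * G}) : stretch F <= #|G|.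
Proof. by apply/bigmax_leqP => e _; apply: gdist_le_card. Qed.

(* The index #|G| bounds every stretch, so this is the minimum over all spanning
   trees as soon as there is one; see tree_stretchP. *)
Definition tree_stretch (G : sgraph) : nat :=
  \big[minn/#|G|]_(F : {set G * G} | spanning_tree F) stretch F.

Lemma tree_stretch_le (G : sgraph) (F : {set G * G}) :
  spanning_tree F -> tree_stretch G <= stretch F.
Proof.
move=> tF; rewrite /tree_stretch.
elim: (index_enum _) (mem_index_enum F) => // F' r IH.
rewrite in_cons big_cons => /predU1P[<-|/IH le_r]; first by rewrite tF geq_minl.
by case: ifP => // _; rewrite geq_min le_r orbT.
Qed.

Lemma tree_stretchP (G : sgraph) (F0 : {set G * G}) :
  spanning_tree F0 ->
  exists2 F : {set G * G}, spanning_tree F &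
    tree_stretch G = stretch F /\
    (forall F' : {set G * G}, spanning_tree F' -> stretch F <= stretch F').
Proof.
move=> tF0; have [F tF minF] := arg_minnP (@stretch G) tF0.
exists F => //; split=> //; apply/eqP; rewrite eqn_leq tree_stretch_le //=.
apply: (big_ind (fun k => stretch F <= k)) => [|a b Fa Fb|F' /minF //].
  exact: stretch_le_card.
by rewrite leq_min Fa.
Qed.

Section TriangulatedGrid.

Variables m n : nat.

(* The pair (x, y) is the grid point with abscissa x < n and ordinate y < m. *)
Definition tri_grid_adj (u v : 'I_n * 'I_m) : bool :=
  (`|u.1 - v.1| + `|u.2 - v.2| == 1)
  || (`|u.1 - v.1| + `|u.2 - v.2| == 2) && (u.1 + u.2 == v.1 + v.2).

Lemma tri_grid_adj_sym : symmetric tri_grid_adj.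
Proof.
by move=> u v; rewrite /tri_grid_adj (distnC u.1) (distnC u.2) (eq_sym (u.1 + _)).
Qed.

Lemma tri_grid_adj_irrefl : irreflexive tri_grid_adj.
Proof. by move=> u; rewrite /tri_grid_adj !distnn. Qed.

Definition tri_grid : sgraph := SGraph tri_grid_adj_sym tri_grid_adj_irrefl.

End TriangulatedGrid.

(* Main.v *)
Require Import Defs.
From mathcomp Require Import all_boot ssrint zify.

Set Implicit Arguments.
Unset Strict Implicit.
Unset Printing Implicit Defensive.

(** Upper bound.  Keep every column of the grid and join consecutive columns by
    one edge, from (x, m./2) to (x.+1, m.-1./2): horizontal if m is odd, diagonal
    if m is even.  An edge between columns x and x.+1 is then replaced by a detour
    along column x to the middle, across, and along column x.+1, of at most m steps
    because the two attachment rows add up to m - 1 ([middle_rows_detour]).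
    This comb is a tree because every vertex but the root has exactly one parent,
    which is lower for a suitable height ([parent_arcs_spanning]).

    Lower bound.  Let T be a spanning tree of stretch less than m.  Removing an
    edge ab of T splits the vertices into the side of a and the side of b.  If an
    edge uv of the grid goes from the first to the second, the tree path from u
    to v runs from u to a, through ab, and from b to v.  So if u and v lie on one
    boundary side of the grid, the distances of a and b to that boundary side add
    up to at most m - 2 ([cut_edge_stretch]).

    Now let ab be on the tree path from the corner p = (0, 0) to the opposite
    corner q = (n-1, m-1); it separates p from q.  Look at which sides of the cut
    the other two corners are on.  If they are on different sides, two opposite
    boundary sides of the grid are both cut; the two resulting bounds add up to
    at most 2m - 4, but the four distances have sum at least 2m - 2.  If both are
    on the side of b, the bottom and the left are cut, and the sum S of the four
    coordinates of a and b is at most 2m - 4; if both are on the side of a, the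
    top and the right are cut, and S is at least 2n ([corner_cut_level]).

    Along the path from p to q, the sum x + y changes by at most 1 per step, since
    the diagonals of the grid preserve it, so S changes by at most 2 from one edge
    to the next.  It cannot jump the gap from 2m - 4 to 2n; yet it is small on the
    first edge and large on the last one ([small_stretch_absurd]). *)

(** * Fundamental cuts of a tree *)

Section Cut.

Variables (V : finType) (t : rel V).
Hypothesis t_sym : symmetric t.

Definition del_edge (a b : V) : rel V :=
  [rel x y | [&& t x y, (x, y) != (a, b) & (x, y) != (b, a)]].

Definition side (a b : V) : pred V := connect (del_edge a b) a.

Lemma del_edge_sym a b : symmetric (del_edge a b).
Proof.
move=> x y; rewrite /del_edge /= t_sym !xpair_eqE.
by rewrite (andbC (x == a)) (andbC (x == b)); congr (_ && _); rewrite andbC.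
Qed.

(** A single step leaves the side of [a] only through the deleted edge, and in
    the direction from [a] to [b]: the step from [b] to [a] would end in
    that side. *)
Lemma side_step a b x y :
  t x y -> side a b x -> ~~ side a b y -> x = a /\ y = b.
Proof.
move=> txy ax ay.
have : ~~ del_edge a b x y.
  by apply: contra ay => dxy; apply: connect_trans ax (connect1 dxy).
rewrite /del_edge /= txy /= negb_and !negbK => /orP[] /eqP[-> y_eq] //.
by move: ay; rewrite y_eq /side connect0.
Qed.

Lemma walk_crosses a b u p :
    path t u p -> side a b u -> ~~ side a b (last u p) ->
  exists p1 p2, p = p1 ++ b :: p2 /\ last u p1 = a.
Proof.
elim: p u => [|x p IH] u /=; first by move=> _ ->.
move=> /andP[tux tp] au al; case: (boolP (side a b x)) => ax.
  by have [p1 [p2 [-> la]]] := IH x tp ax al; exists (x :: p1), p2.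
by have [-> ->] := side_step tux au ax; exists [::], p.
Qed.

Hypothesis t_acyclic : acyclic t.

(** A path from [a] to [b] that avoids the edge ab would close up with it into a
    cycle. *)
Lemma side_other_end a b : t b a -> a != b -> ~~ side a b b.
Proof.
move=> tba ab; apply/negP => /connectP[q dq b_eq].
case: (shortenP dq) b_eq => q' dq' uq' _ b_eq.
have tq' : path t a q'.
  by apply: sub_path dq' => x y /= /and3P[].
move/acyclicP: t_acyclic => /(_ (a :: q')); case.
  case: q' b_eq dq' {uq' tq'} => [b_eq|x [|//] /= <-].
    by rewrite b_eq eqxx in ab.
  by rewrite /del_edge /= eqxx /= andbF.
by rewrite /ucycle /= rcons_path tq' -b_eq tba.
Qed.

(** The part of a simple path before the edge ab avoids [b] and the part after it
    avoids [a], so neither part uses that edge; hence each stays on its side. *)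
Lemma path_separates p w1 b w2 (a := last p w1) :
    path t p (w1 ++ b :: w2) -> uniq (p :: w1 ++ b :: w2) ->
  side a b p /\ ~~ side a b (last b w2).
Proof.
rewrite cat_path => /and3P[tw1 tab tw2]; rewrite -/a in tab.
rewrite -cat_cons cat_uniq => /and3P[_ disj /andP[b_w2 _]].
have a_in : a \in p :: w1 by rewrite mem_last.
have b_out : b \notin p :: w1.
  by apply: contra disj => b_in; apply/hasP; exists b; rewrite ?mem_head.
have a_out : a \notin b :: w2.
  by apply: contra disj => a_in2; apply/hasP; exists a.
have keep x q : (a \notin x :: q) || (b \notin x :: q) ->
    path t x q -> connect (del_edge a b) x (last x q).
  move=> out tq; apply/connectP; exists q => //.
  elim: q x out tq => //= y q IH x out /andP[txy tq].
  rewrite IH ?andbT //.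
    rewrite /del_edge /= txy !xpair_eqE /=; move: out; rewrite !inE !negb_or.
    rewrite !(eq_sym a) !(eq_sym b).
    by case: (x == a); case: (x == b); case: (y == a); case: (y == b).
  by move: out; rewrite !(in_cons x) !negb_or => /orP[] /andP[_ ->]; rewrite ?orbT.
have csym := sym_connect_sym (del_edge_sym a b).
split; first by rewrite /side csym keep // b_out orbT.
have ab : a != b by apply: contraNneq b_out => <-.
have tba : t b a by rewrite t_sym.
apply: contra (side_other_end tba ab) => a_last.
by apply: (connect_trans a_last); rewrite csym keep ?a_out.
Qed.

End Cut.

(** * Cuts of a spanning tree and the stretch *)

Section CutStretch.

Variables (G : sgraph) (F : {set G * G}).
Hypothesis treeF : spanning_tree F.

Lemma spanning_tree_sym : symmetric (arc_rel F).
Proof. by case/and4P: treeF => /forallP s _ _ _ u v; apply/eqP/(forallP (s u)). Qed.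

Lemma spanning_tree_adj u v : arc_rel F u v -> adj u v.
Proof. by case/and4P: treeF => _ /forallP s _ _; apply/implyP/(forallP (s u)). Qed.

Lemma spanning_tree_connect u v : connect (arc_rel F) u v.
Proof. by case/and4P: treeF => _ _ /forallP s _; apply/(forallP (s u)). Qed.

Lemma spanning_tree_acyclic : acyclic (arc_rel F).
Proof. by case/and4P: treeF. Qed.

(** In the application to the grid, [pi] is the distance to one of the four
    boundary sides, so that its zeros form that side. *)
Variable pi : G -> nat.
Hypothesis pi_lip : forall u v : G, adj u v -> pi u <= (pi v).+1.

Lemma potential_walk u p :
  path (arc_rel F) u p ->
  pi u <= pi (last u p) + size p /\ pi (last u p) <= pi u + size p.
Proof.
elim: p u => [|x p IH] u /=; first by rewrite addn0.
move=> /andP[/spanning_tree_adj ux /IH[le1 le2]].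
have := pi_lip ux; rewrite adj_sym in ux; have := pi_lip ux.
lia.
Qed.

(** The tree path from [u] to [v] consists of a part from [u] to [a], of length at
    least [pi a], the edge ab, and a part from [b] to [v], of length at least
    [pi b]. *)
Lemma cut_edge_stretch a b u v :
    adj u v -> pi u = 0 -> pi v = 0 ->
    side (arc_rel F) a b u -> ~~ side (arc_rel F) a b v ->
  pi a + pi b < stretch F.
Proof.
move=> uv u0 v0 au av.
have le_s : gdist (arc_rel F) u v <= stretch F.
  exact: (@leq_bigmax_cond _ (fun e : G * G => adj e.1 e.2)
            (fun e => gdist (arc_rel F) e.1 e.2) (u, v) uv).
apply: leq_trans le_s.
have /has_walkP[p [tp lp <-]] := gdist_walk (spanning_tree_connect u v).
move: av tp; rewrite -lp => av tp.
have [p1 [p2 [p_eq la]]] := walk_crosses tp au av.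
move: tp lp; rewrite p_eq cat_path last_cat size_cat /= => /and3P[tp1 _ tp2] lp.
have := potential_walk tp1; have := potential_walk tp2.
rewrite la lp; lia.
Qed.

(** If the ends of a walk of zeros of [pi] are separated by the cut, so are the
    ends of one of its steps. *)
Lemma cut_wall_stretch a b (f : nat -> G) k :
    (forall i, i < k -> adj (f i) (f i.+1)) ->
    (forall i, i <= k -> pi (f i) = 0) ->
    side (arc_rel F) a b (f 0) != side (arc_rel F) a b (f k) ->
  pi a + pi b < stretch F.
Proof.
elim: k => [|k IH] adj_f f0; first by rewrite eqxx.
case: (eqVneq (side (arc_rel F) a b (f 0)) (side (arc_rel F) a b (f k))).
  move=> -> ne_k; have fk := f0 k (leqnSn k); have fk1 := f0 k.+1 (leqnn _).
  have ak := adj_f k (leqnn _).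
  case: (boolP (side _ _ _ (f k))) ne_k => sk;
    case: (boolP (side _ _ _ (f k.+1))) => // sk1 _.
    exact: cut_edge_stretch ak fk fk1 sk sk1.
  by rewrite adj_sym in ak; apply: cut_edge_stretch ak fk1 fk sk1 sk.
move=> ne _; apply: IH ne => i lt_i; first by apply: adj_f; apply: ltnW.
by apply: f0; apply: ltnW.
Qed.

End CutStretch.

(** * Lower bound *)

Lemma inord_0 k : inord 0 = ord0 :> 'I_k.+1.
Proof. by apply: val_inj; rewrite /= inordK. Qed.

Lemma inord_max k : inord k = ord_max :> 'I_k.+1.
Proof. by apply: val_inj; rewrite /= inordK. Qed.

(** The grid has [m.+1] rows and [n.+1] columns here, so that its corners can be
    written with [ord0] and [ord_max]; a stretch of at most [m] is then one that is
    less than the number of rows. *)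
Section LowerBound.

Variables (m n : nat) (F : {set tri_grid m.+1 n.+1 * tri_grid m.+1 n.+1}).
Hypotheses (treeF : spanning_tree F) (stretchF : stretch F <= m)
           (m_gt0 : 0 < m) (le_mn : m <= n).

(* The diagonal edges keep x + y constant, so one edge changes it by at most 1. *)
Let level (u : tri_grid m.+1 n.+1) : nat := u.1 + u.2.

Lemma tri_grid_level_lip u v : adj u v -> level u <= (level v).+1.
Proof. by rewrite /level /= /tri_grid_adj; lia. Qed.

(** Two opposite boundary sides cannot both be cut; the coordinates of [a] and [b]
    are small if the bottom and the left are cut, and large if the top and the
    right are. *)
Lemma corner_cut_level a b :
    side (arc_rel F) a b (ord0, ord0) -> ~~ side (arc_rel F) a b (ord_max, ord_max) ->
  level a + level b + 2 <= 2 * m \/ 2 * n + 2 <= level a + level b.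
Proof.
set S := side _ a b => Sp /negbTE Sq.
have bottom : S (ord0, ord0) != S (ord_max, ord0) -> a.2 + b.2 < m.
  move=> ne; apply: leq_trans stretchF.
  apply: (@cut_wall_stretch _ _ treeF (fun u => u.2 : nat) _ a b
            (fun i => (inord i, ord0)) n) => [u v|i lt_i|//|].
  - by rewrite /= /tri_grid_adj; lia.
  - by rewrite /= /tri_grid_adj /= !inordK; lia.
  - by rewrite inord_0 inord_max.
have top : S (ord0, ord_max) != S (ord_max, ord_max) -> (m - a.2) + (m - b.2) < m.
  move=> ne; apply: leq_trans stretchF.
  apply: (@cut_wall_stretch _ _ treeF (fun u => m - u.2) _ a b
            (fun i => (inord i, ord_max)) n) => [u v|i lt_i|i _|].
  - by rewrite /= /tri_grid_adj; lia.
  - by rewrite /= /tri_grid_adj /= !inordK; lia.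
  - by rewrite /= subnn.
  - by rewrite inord_0 inord_max.
have left : S (ord0, ord0) != S (ord0, ord_max) -> a.1 + b.1 < m.
  move=> ne; apply: leq_trans stretchF.
  apply: (@cut_wall_stretch _ _ treeF (fun u => u.1 : nat) _ a b
            (fun i => (ord0, inord i)) m) => [u v|i lt_i|//|].
  - by rewrite /= /tri_grid_adj; lia.
  - by rewrite /= /tri_grid_adj /= !inordK; lia.
  - by rewrite inord_0 inord_max.
have right : S (ord_max, ord0) != S (ord_max, ord_max) -> (n - a.1) + (n - b.1) < m.
  move=> ne; apply: leq_trans stretchF.
  apply: (@cut_wall_stretch _ _ treeF (fun u => n - u.1) _ a b
            (fun i => (ord_max, inord i)) m) => [u v|i lt_i|i _|].
  - by rewrite /= /tri_grid_adj; lia.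
  - by rewrite /= /tri_grid_adj /= !inordK; lia.
  - by rewrite /= subnn.
  - by rewrite inord_0 inord_max.
(* The cases are given by the bottom right and the top left corner, in this
   order; the two middle ones, where opposite boundary sides are cut, are
   contradictory. *)
move: bottom top left right; rewrite Sp Sq /level.
case: (S (ord_max, ord0)); case: (S (ord0, ord_max)) => /= bottom top left right.
- by move: (top isT) (right isT); lia.
- by move: (left isT) (right isT); lia.
- by move: (bottom isT) (top isT); lia.
- by move: (bottom isT) (left isT); lia.
Qed.

(** A discrete intermediate value argument: the sum of the levels of the ends of
    an edge avoids an interval that is too wide for one step along the path. *)
Lemma small_stretch_absurd : False.
Proof.
pose p : tri_grid m.+1 n.+1 := (ord0, ord0).
pose q : tri_grid m.+1 n.+1 := (ord_max, ord_max).
have /connectP[w0 tw0 q_eq] := spanning_tree_connect treeF p q.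
case: (shortenP tw0) q_eq => w tw uw _ q_eq {w0 tw0}.
have key w1 b w2 (a := last p w1) : w = w1 ++ b :: w2 ->
    adj a b /\ (level a + level b + 2 <= 2 * m \/ 2 * n + 2 <= level a + level b).
  move=> w_eq; have := tw; have := uw; rewrite w_eq => uw' tw'.
  have [Sp Sq] := path_separates (spanning_tree_sym treeF)
                    (spanning_tree_acyclic treeF) tw' uw'.
  have b_last : last b w2 = q by rewrite q_eq w_eq last_cat.
  rewrite b_last in Sq; split; last exact: corner_cut_level Sp Sq.
  by move: tw'; rewrite cat_path => /and3P[_ /(spanning_tree_adj treeF)].
have low w1 b w2 : w = w1 ++ b :: w2 -> level (last p w1) + level b + 2 <= 2 * m.
  elim/last_ind: w1 b w2 => [|w1 a IH] b w2 w_eq;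
    have [ab S_ab] := key _ _ _ w_eq; rewrite adj_sym in ab;
    have := tri_grid_level_lip ab.
    by move: S_ab; have -> : level (last p [::]) = 0 by []; lia.
  rewrite cat_rcons in w_eq; have := IH _ _ w_eq.
  have [aa' _] := key _ _ _ w_eq; rewrite adj_sym in aa'.
  move: (tri_grid_level_lip aa') S_ab; rewrite last_rcons; lia.
case/lastP: w q_eq low {tw uw key} => [|w b].
  by move=> /(congr1 (fun u : tri_grid _ _ => u.1 : nat)) /=; have := m_gt0; lia.
rewrite last_rcons => <- /(_ w q [::]); rewrite cats1 => /(_ erefl).
by rewrite {2}/level /=; lia.
Qed.

End LowerBound.

(** * Trees given by a parent relation *)

Section ParentTree.

Variables (G : sgraph) (root : G) (up : rel G) (h : G -> nat).
Hypotheses (up_adj : forall u v, up u v -> adj u v)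
           (up_lt : forall u v, up u v -> h v < h u)
           (up_fun : forall u v w, up u v -> up u w -> v = w)
           (up_ex : forall u, u != root -> exists v, up u v).

Definition parent_arcs : {set G * G} := [set e | up e.1 e.2 || up e.2 e.1].

Lemma parent_arcsE u v : arc_rel parent_arcs u v = up u v || up v u.
Proof. by rewrite /arc_rel /= inE. Qed.

Lemma parent_arcs_sym : symmetric (arc_rel parent_arcs).
Proof. by move=> u v; rewrite !parent_arcsE orbC. Qed.

Lemma parent_arcs_connect u : connect (arc_rel parent_arcs) u root.
Proof.
have [k] := ubnP (h u); elim: k u => // k IH u lt_k.
have [->|/up_ex[v uv]] := eqVneq u root; first exact: connect0.
apply: (@connect_trans _ _ v); first by apply: connect1; rewrite parent_arcsE uv.
by apply: IH; apply: leq_trans (up_lt uv) _.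
Qed.

(** At a vertex of a cycle where the height [h] is largest, both cycle neighbors
    would have to be the parent, but they are distinct. *)
Lemma parent_arcs_acyclic : acyclic (arc_rel parent_arcs).
Proof.
apply/acyclicP => c c_gt2 c_cycle.
have [x0 x0c] : exists x, x \in c.
  by case: c c_gt2 {c_cycle} => // x c _; exists x; apply: mem_head.
have [x xc max_x] := arg_maxnP h (P := mem c) x0c.
have toward y : y \in c -> up x y || up y x -> up x y.
  by move=> /max_x /= le_yx /orP[//|/up_lt]; lia.
have [i c' c_rot] := rot_to xc.
have mem_c' y : y \in c' -> y \in c.
  by move=> yc'; rewrite -(mem_rot i) c_rot inE yc' orbT.
move: c_gt2 c_cycle; rewrite -(size_rot i) /ucycle -(rot_cycle i) -(rot_uniq i) c_rot.
case: c' {c_rot} mem_c' => [|y [|z c']] //= mem_c' _.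
rewrite rcons_path => /and4P[/andP[xy /andP[_ /andP[_ zx]]] _ y_out _].
move: xy zx; rewrite !parent_arcsE orbC => xy zx.
have x_y : up x y by apply: toward; [apply: mem_c'; rewrite mem_head | rewrite orbC].
have x_z : up x (last z c').
  by apply: toward; [apply: mem_c'; rewrite in_cons mem_last orbT | rewrite orbC].
by move: y_out; rewrite (up_fun x_y x_z) mem_last.
Qed.

Lemma parent_arcs_spanning : spanning_tree parent_arcs.
Proof.
apply/and4P; split; last exact: parent_arcs_acyclic.
- by apply/forallP => u; apply/forallP => v; rewrite parent_arcs_sym.
- apply/forallP => u; apply/forallP => v; apply/implyP; rewrite parent_arcsE.
  by case/orP => /up_adj //; rewrite adj_sym.
- apply/forallP => u; apply/forallP => v.
  apply: connect_trans (parent_arcs_connect u) _.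
  by rewrite (sym_connect_sym parent_arcs_sym) parent_arcs_connect.
Qed.

End ParentTree.

(** * Upper bound *)

Lemma has_walk_cat (V : finType) (t : rel V) u v w k l :
  has_walk t u v k -> has_walk t v w l -> has_walk t u w (k + l).
Proof.
move=> /has_walkP[p [tp <- <-]] /has_walkP[q [tq <- <-]].
by apply/has_walkP; exists (p ++ q); rewrite cat_path tp tq last_cat size_cat.
Qed.

Lemma has_walk1 (V : finType) (t : rel V) u v : t u v -> has_walk t u v 1.
Proof. by move=> tuv; apply/has_walkP; exists [:: v]; rewrite /= tuv. Qed.

Lemma has_walk_sym (V : finType) (t : rel V) u v k :
  symmetric t -> has_walk t u v k -> has_walk t v u k.
Proof.
move=> t_sym /has_walkP[p [tp <- <-]]; apply/has_walkP.
exists (rev (belast u p)); split; last by rewrite size_rev size_belast.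
  by rewrite rev_path (eq_path (e' := t)) // => x y; rewrite t_sym.
by case: p {tp} => //= x p; rewrite rev_cons last_rcons.
Qed.

Lemma gdist_sym (V : finType) (t : rel V) :
  symmetric t -> forall u v, gdist t u v = gdist t v u.
Proof.
by move=> t_sym u v; apply: eq_find => k; apply/idP/idP; apply: has_walk_sym.
Qed.

(** Rows [lo] and [hi] are the two middle rows, equal when [m] is odd.  The
    descending diagonal of the grid goes from row [y'.+1] to row [y'] of the next
    column, and the connecting edge of the comb from [hi] to [lo] in the same
    sense; this is why the bound also holds for [m] even. *)
Lemma middle_rows_detour m lo hi y y' :
    lo + hi = m.-1 -> lo <= hi <= lo.+1 -> y < m -> y' < m ->
    y' = y \/ y = y'.+1 ->
  `|y - hi| + (1 + `|lo - y'|) <= m.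
Proof. by move=> ? ? ? ? [->|y_eq]; lia. Qed.

Section UpperBound.

Variables m n : nat.
Let lo := m.-1./2.
Let hi := m./2.

(** The comb is oriented toward the root (0, [lo]), so that the edge between two
    columns is entered in row [lo] of the right one. *)
Definition comb_parent (u v : tri_grid m n) : bool :=
  (u.1 == v.1) && ((u.2 < lo) && (v.2 == u.2.+1 :> nat)
                   || (lo < u.2) && (u.2 == v.2.+1 :> nat))
  || [&& u.2 == lo :> nat, u.1 == v.1.+1 :> nat & v.2 == hi :> nat].

Definition comb : {set tri_grid m n * tri_grid m n} := parent_arcs comb_parent.

Lemma comb_sym : symmetric (arc_rel comb).
Proof. exact: parent_arcs_sym. Qed.

Lemma comb_spanning : 0 < m -> 0 < n -> spanning_tree comb.
Proof.
move=> m_gt0 n_gt0.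
have lo_lt : lo < m by rewrite /lo; lia.
have hi_lt : hi < m by rewrite /hi; lia.
rewrite /comb.
(* This height puts every vertex of a column above the whole previous column,
   because the distance to row [lo] is less than m. *)
apply: (@parent_arcs_spanning (tri_grid m n) (Ordinal n_gt0, Ordinal lo_lt) _
          (fun u : tri_grid m n => u.1 * m + `|u.2 - lo|)).
- move=> u v; rewrite /= /tri_grid_adj /comb_parent -val_eqE /= /lo /hi; lia.
- move=> [x y] [x' y']; rewrite /comb_parent -val_eqE /= => H.
  case/orP: H => [|/and3P[/eqP-> /eqP-> /eqP->]]; last by rewrite /lo /hi mulSn; lia.
  by case/andP=> /eqP->; lia.
- move=> [x y] [x1 y1] [x2 y2]; rewrite /comb_parent -!val_eqE /= => H1 H2.
  by congr (_, _); apply: val_inj => /=; lia.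
- move=> [x y]; rewrite xpair_eqE -!val_eqE /= => ne.
  case: (ltngtP y lo) => [lt_y|gt_y|y_lo].
  + have y1 : y.+1 < m by lia.
    by exists (x, Ordinal y1); rewrite /comb_parent /= !eqxx lt_y.
  + have y1 : y.-1 < m by have := ltn_ord y; lia.
    exists (x, Ordinal y1); rewrite /comb_parent /= !eqxx gt_y.
    by rewrite prednK ?eqxx ?orbT //; lia.
  + have x1 : x.-1 < n by have := ltn_ord x; lia.
    exists (Ordinal x1, Ordinal hi_lt); rewrite /comb_parent /= y_lo !eqxx.
    by rewrite prednK ?eqxx ?orbT //; lia.
Qed.

Lemma comb_column x (y y' : 'I_m) : has_walk (arc_rel comb) (x, y) (x, y') `|y - y'|.
Proof.
wlog le_yy' : y y' / y <= y'.
  move=> IH; case/orP: (leq_total y y') => [/IH //|/IH W].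
  by rewrite distnC; apply: has_walk_sym comb_sym W.
rewrite distnEr //; have [k] := ubnPeq (y' - y).
elim: k y' le_yy' => [|k IH] y' le_yy' eq_k.
  have -> : y' = y by apply: val_inj => /=; lia.
  by apply/has_walkP; exists [::].
have y1 : y'.-1 < m by have := ltn_ord y'; lia.
rewrite -addn1; apply: (@has_walk_cat _ _ _ (x, Ordinal y1)).
  by apply: IH => /=; lia.
apply: has_walk1; rewrite parent_arcsE /comb_parent /= !eqxx /=; lia.
Qed.

Lemma comb_step (u v : tri_grid m n) :
  v.1 = u.1.+1 :> nat -> adj u v -> gdist (arc_rel comb) u v <= m.
Proof.
case: u v => [x y] [x' y'] /= x'_eq adj_uv.
have m_gt0 : 0 < m by have := ltn_ord y; lia.
have lo_lt : lo < m by rewrite /lo; lia.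
have hi_lt : hi < m by rewrite /hi; lia.
have rung : arc_rel comb (x, Ordinal hi_lt) (x', Ordinal lo_lt).
  by rewrite parent_arcsE /comb_parent /= x'_eq !eqxx !orbT.
have /has_walkP[p [tp lp p_size]] :=
  has_walk_cat (comb_column x y (Ordinal hi_lt))
    (has_walk_cat (has_walk1 rung) (comb_column x' (Ordinal lo_lt) y')).
apply: leq_trans (gdist_min tp lp) _; rewrite p_size /=.
have y'_eq : y' = y :> nat \/ y = y'.+1 :> nat.
  by move: adj_uv; rewrite /tri_grid_adj /= x'_eq; lia.
have lo_hi : lo + hi = m.-1 /\ lo <= hi <= lo.+1 by rewrite /lo /hi; lia.
by case: lo_hi => ? ?; apply: middle_rows_detour; rewrite ?ltn_ord.
Qed.

Lemma comb_stretch : stretch comb <= m.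
Proof.
apply/bigmax_leqP => -[[x y] [x' y']] /= adj_uv.
have close : x <= x'.+1 /\ x' <= x.+1 by move: adj_uv; rewrite /tri_grid_adj /=; lia.
have [lt_x|lt_x|eq_x] := ltngtP x x'.
- by apply: comb_step => //=; lia.
- rewrite (gdist_sym comb_sym); apply: comb_step => /=; first lia.
  by rewrite tri_grid_adj_sym.
have {eq_x} <- : x = x' by apply: val_inj.
have /has_walkP[p [tp lp p_size]] := comb_column x y y'.
apply: leq_trans (gdist_min tp lp) _.
have := ltn_ord y; move: adj_uv; rewrite /tri_grid_adj /= p_size; lia.
Qed.

End UpperBound.

Theorem theorem4p3 (m n : nat) (hm : 2 <= m) (hmn : m <= n) :
  tree_stretch (tri_grid m n) = m.
Proof.
have comb_tree : spanning_tree (comb m n) by apply: comb_spanning; lia.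
apply/eqP; rewrite eqn_leq; apply/andP; split.
  exact: leq_trans (tree_stretch_le comb_tree) (comb_stretch m n).
have [F treeF [-> _]] := tree_stretchP comb_tree.
rewrite leqNgt; apply/negP => lt_m.
case: m n hm hmn F treeF lt_m {comb_tree} => // m' [|n'] // hm hmn F treeF lt_m.
exact: (small_stretch_absurd treeF lt_m hm hmn).
Qed.
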